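(* Let $K$ be a totally real number field, $S\subset\mathcal{O}_K^+/\mathcal{U}_K^2$, $\mathcal{C}\subset S$, and $X\in\{\mathrm{cl},\mathrm{nc}\}$. Then $\mathcal{C}$ is an $(S,X)$-criterion set if and only if for every free $X$-lattice $L$ over $K$: $L$ is $S$-universal if and only if $L$ is $\mathcal{C}$-universal.
   Context: $K$ totally real, $\mathcal{O}_K$ its ring of integers, $\mathcal{U}_K$ its unit group, $\mathcal{O}_K^+$ the totally positive integers, $\mathcal{O}_K^+/\mathcal{U}_K^2$ the set of classes $\alpha\mathcal{U}_K^2$. A lattice over $K$ is a finitely generated torsion-free $\mathcal{O}_K$-module $L$ with a quadratic map $Q:L\to\mathcal{O}_K$ ($Q(av)=a^2Q(v)$, $B(v,w)=(Q(v+w)-Q(v)-Q(w))/2$ bilinear) with $Q(v)\in\mathcal{O}_K^+$ for $v\neq0$; classical if $B$ is $\mathcal{O}_K$-valued; free if $L$ is a free $\mathcal{O}_K$-module. An $X$-lattice is any lattice for $X=\mathrm{nc}$ and a classical lattice for $X=\mathrm{cl}$. $L$ represents $\alpha$ if $Q(v)=\alpha$ for some $v$; for a set $T$ of classes, $L$ is $T$-universal if it represents every element whose class lies in $T$. A subset $\mathcal{C}\subset S$ is an $(S,X)$-criterion set if every $X$-lattice (free or not) is $S$-universal if and only if it is $\mathcal{C}$-universal. *)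

(* Defs.v *)
From HB Require Import structures.
From mathcomp Require Import all_boot all_order all_algebra all_field.
From mathcomp Require Import boolp classical_sets.

Set Implicit Arguments.
Unset Strict Implicit.
Unset Printing Implicit Defensive.

Import Order.TTheory GRing.Theory Num.Theory.
Local Open Scope ring_scope.
Local Open Scope classical_set_scope.

(* A number field is a [fieldExtType rat]. Its complex embeddings take
   algebraic values, so they are the ring morphisms into [algC]. *)
Definition totally_real (K : fieldExtType rat) : Prop :=
  forall (s : {rmorphism K -> algC}) (x : K), s x \is Num.real.

Definition integral (K : fieldExtType rat) : {pred K} :=
  fun x => `[< integralOver (intr : int -> K) x >].
Arguments integral K : clear implicits.

Lemma integralP (K : fieldExtType rat) (x : K) :
  reflect (integralOver (intr : int -> K) x) (x \in integral K).
Proof. exact: asboolP. Qed.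

Lemma integral_subring_closed (K : fieldExtType rat) :
  subring_closed (integral K).
Proof.
split.
- exact/integralP/integral1.
- by move=> x y /integralP ? /integralP ?; exact/integralP/integral_sub.
- by move=> x y /integralP ? /integralP ?; exact/integralP/integral_mul.
Qed.

HB.instance Definition _ (K : fieldExtType rat) :=
  GRing.isSubringClosed.Build K (integral K) (@integral_subring_closed K).

Record ringOfIntegers (K : fieldExtType rat) := RingOfIntegers {
  integer_val :> K;
  integer_valP : integer_val \in integral K
}.

Section RingOfIntegersStructure.
Variable K : fieldExtType rat.
Local Notation O := (ringOfIntegers K).

HB.instance Definition _ := [isSub for @integer_val K].
HB.instance Definition _ := [Choice of O by <:].
HB.instance Definition _ := [SubChoice_isSubComNzRing of O by <:].

Fact integer_val_is_zmod_morphism : zmod_morphism (@integer_val K).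
Proof. exact: (rmorphB (val : {rmorphism O -> K})). Qed.

Fact integer_val_is_monoid_morphism : monoid_morphism (@integer_val K).
Proof.
by split; [exact: (rmorph1 (val : {rmorphism O -> K}))
          | exact: (rmorphM (val : {rmorphism O -> K}))].
Qed.

HB.instance Definition _ := GRing.isZmodMorphism.Build O K (@integer_val K)
  integer_val_is_zmod_morphism.
HB.instance Definition _ := GRing.isMonoidMorphism.Build O K (@integer_val K)
  integer_val_is_monoid_morphism.

Definition integer_unit : {pred O} :=
  fun x => (integer_val x != 0) && ((integer_val x)^-1 \in integral K).

Definition integer_inv (x : O) : O :=
  if x \in integer_unit then insubd x (integer_val x)^-1 else x.

Lemma integer_invE (x : O) :
  x \in integer_unit -> integer_val (integer_inv x) = (integer_val x)^-1.
Proof.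
move=> xU; rewrite /integer_inv xU.
by case/andP: xU => _ xi; apply: (etrans (val_insubd _ _)); rewrite xi.
Qed.

Lemma integer_mulVx : {in integer_unit, left_inverse 1 integer_inv *%R}.
Proof.
move=> x xU; apply: val_inj.
rewrite -[LHS]/(integer_val _) -[RHS]/(integer_val _) rmorphM rmorph1 /= integer_invE //.
by case/andP: xU => x0 _; rewrite mulVf.
Qed.

Lemma integer_unitPl (x y : O) : y * x = 1 -> integer_unit x.
Proof.
move=> /(congr1 (@integer_val K)); rewrite rmorphM rmorph1 /= => yx1.
have x0 : integer_val x != 0.
  by apply: contra_eq_neq yx1 => ->; rewrite mulr0 eq_sym oner_neq0.
rewrite /integer_unit x0 /=.
suff -> : (integer_val x)^-1 = integer_val y by exact: integer_valP.
by rewrite -[LHS]mul1r -yx1 mulfK.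
Qed.

Lemma integer_inv_out : {in [predC integer_unit], integer_inv =1 id}.
Proof. by move=> x; rewrite inE /integer_inv => /negbTE ->. Qed.

HB.instance Definition _ := GRing.ComNzRing_hasMulInverse.Build O
  integer_mulVx integer_unitPl integer_inv_out.
HB.instance Definition _ := [SubComUnitRing_isSubIntegralDomain of O by <:].

End RingOfIntegersStructure.

Definition totally_positive (K : fieldExtType rat) : set (ringOfIntegers K) :=
  [set a | forall s : {rmorphism K -> algC}, 0 < s (integer_val a)].

(* The class of [a] modulo squares of units, as a set of integers. *)
Definition sqclass (K : fieldExtType rat) (a : ringOfIntegers K) :
    set (ringOfIntegers K) :=
  [set a * u ^+ 2 | u in [set u | u \is a GRing.unit]].

Definition positive_classes (K : fieldExtType rat) :
    set (set (ringOfIntegers K)) :=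
  [set sqclass a | a in @totally_positive K].
Arguments positive_classes K : clear implicits.

Definition finitely_generated (R : nzRingType) (M : lmodType R) : Prop :=
  exists (n : nat) (g : 'I_n -> M),
    forall v : M, exists c : {ffun 'I_n -> R}, v = \sum_(i < n) c i *: g i.

Definition torsion_free (R : nzRingType) (M : lmodType R) : Prop :=
  forall (a : R) (v : M), a *: v = 0 -> a = 0 \/ v = 0.

(* Freeness of finite rank; for a finitely generated module over a nonzero
   commutative ring, every basis is finite. *)
Definition free_module (R : nzRingType) (M : lmodType R) : Prop :=
  exists (n : nat) (e : 'I_n -> M),
    forall v : M, exists! c : {ffun 'I_n -> R}, v = \sum_(i < n) c i *: e i.

(* [Q] is integral, but the factor 1/2 puts the values of its bilinear form
   in [K] only. *)
Definition polar_form (K : fieldExtType rat) (M : lmodType (ringOfIntegers K))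
    (Q : M -> ringOfIntegers K) (v w : M) : K :=
  integer_val (Q (v + w) - Q v - Q w) / 2.

Definition bilinear_form (K : fieldExtType rat)
    (M : lmodType (ringOfIntegers K)) (B : M -> M -> K) : Prop :=
  (forall (a : ringOfIntegers K) (u v w : M),
      B (a *: u + v) w = integer_val a * B u w + B v w) /\
  (forall (a : ringOfIntegers K) (u v w : M),
      B w (a *: u + v) = integer_val a * B w u + B w v).

Record lattice (K : fieldExtType rat) := Lattice {
  lattice_module :> lmodType (ringOfIntegers K);
  lattice_form : lattice_module -> ringOfIntegers K;
  lattice_fg : finitely_generated lattice_module;
  lattice_torsion_free : torsion_free lattice_module;
  lattice_formZ : forall (a : ringOfIntegers K) (v : lattice_module),
    lattice_form (a *: v) = a ^+ 2 * lattice_form v;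
  lattice_bilinear : bilinear_form (polar_form lattice_form);
  lattice_positive : forall v : lattice_module,
    v != 0 -> totally_positive (lattice_form v)
}.

Definition classical_lattice (K : fieldExtType rat) (L : lattice K) : Prop :=
  forall v w : L, polar_form (@lattice_form K L) v w \in integral K.

Definition free_lattice (K : fieldExtType rat) (L : lattice K) : Prop :=
  free_module L.

Inductive lattice_kind := cl | nc.

Definition of_kind (X : lattice_kind) (K : fieldExtType rat) (L : lattice K) :
    Prop :=
  match X with cl => classical_lattice L | nc => True end.

Definition represents (K : fieldExtType rat) (L : lattice K)
    (a : ringOfIntegers K) : Prop :=
  exists v : L, lattice_form v = a.

Definition universal (K : fieldExtType rat) (T : set (set (ringOfIntegers K)))
    (L : lattice K) : Prop :=
  forall a : ringOfIntegers K,
    totally_positive a -> T (sqclass a) -> represents L a.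

Definition criterion_set (K : fieldExtType rat)
    (S : set (set (ringOfIntegers K))) (X : lattice_kind)
    (C : set (set (ringOfIntegers K))) : Prop :=
  C `<=` S /\
  forall L : lattice K, of_kind X L -> (universal S L <-> universal C L).

(* Main.v *)
(* A nonfree lattice [L] is made free by adding a complement whose form is too
   large to contribute to representing a given totally positive [a]. A finitely
   generated torsion-free module over the ring of integers [O] is projective, so
   [O^m = L (+) P]; extend the form of [L] by [2 a] times the restriction to [P]
   of the sum of squares. This free lattice represents whatever [L] does. If it
   represents [a], then [a = Q v + 2 a b] with [b] a totally nonnegative integer
   all of whose conjugates are at most 1/2; as nonzero integers have norm at
   least 1 in absolute value, [b = 0] and [L] already represents [a].

   Projectivity follows from [O] being a Pruefer domain. If [x] in [K] is a root
   of a primitive integer polynomial with coefficients [c k], its Horner values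
   [w k = x * w (k+1) + c k] are integral, and a Bezout relation between the
   [c k] gives integral [p], [q] with [p x], [q x] integral and
   [p + q x = 1]. *)
Require Import Defs.
From HB Require Import structures.
From mathcomp Require Import all_boot all_order all_algebra all_field.
From mathcomp Require Import boolp classical_sets ring.
Local Open Scope classical_set_scope.

Set Implicit Arguments.
Unset Strict Implicit.
Unset Printing Implicit Defensive.
Import Order.TTheory GRing.Theory Num.Theory.
Local Open Scope ring_scope.

(** * Local divisibility in the ring of integers *)

(** The right side has the shape of the gcd inside [zcontents], so for a primitive polynomial this
    becomes a Bezout relation between the coefficients. *)
Lemma bezout_big (n : nat) (a : 'I_n -> int) :
  exists u : 'I_n -> int, \sum_i u i * a i = (\big[gcdn/0%N]_i `|a i|%N)%:Z.
Proof.
elim: n a => [|n IHn] a; first by exists (fun=> 0); rewrite !big_ord0.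
have [u Eu] := IHn (fun i => a (widen_ord (leqnSn n) i)).
rewrite big_ord_recr /=.
set d := \big[gcdn/0%N]_(i < n) _ in Eu *.
have [v [w Evw]] := Bezoutz d%:Z (a ord_max).
exists (fun i => if unlift ord_max i is Some j then v * u j else w).
rewrite big_ord_recr /= unlift_none -[RHS]Evw -Eu mulr_sumr; congr (_ + _).
apply: eq_bigr => i _; have -> : widen_ord (leqnSn n) i = lift ord_max i.
  by apply: val_inj; rewrite /= /bump leqNgt ltn_ord.
by rewrite liftK mulrA.
Qed.

Section Integrality.
Variable K : fieldExtType rat.
Implicit Types (x : K) (p : {poly K}).

Lemma integral_coef_root x p : p \is monic -> p \is a polyOver (integral K) ->
  root p x -> x \in integral K.
Proof.
move=> p_mon pO px0; apply/integralP/(integral_root_monic p_mon px0).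
by apply/integral_poly => i; apply/integralP/polyOverP.
Qed.

(** Multiplying [p.[x] = 0] by [l ^+ n], with [l] the coefficient of degree [n.+1], gives a monic
    integral equation for [l * x]. *)
Lemma integral_lead_mul x p (n : nat) : p \is a polyOver (integral K) ->
  (size p <= n.+2)%N -> root p x -> p`_n.+1 * x \in integral K.
Proof.
move=> pO szp px0; set l := p`_n.+1.
have lO : l \in integral K by apply/polyOverP.
pose q := 'X^(n.+1) + \poly_(i < n.+1) (p`_i * l ^+ (n - i)).
apply: (@integral_coef_root _ q).
- rewrite monicE lead_coefDl ?lead_coefXn // size_polyXn.
  exact: leq_ltn_trans (size_poly _ _) _.
- rewrite rpredD ?rpredX ?polyOverX //; apply/polyOver_poly => i _.
  by rewrite rpredM ?rpredX //; apply/polyOverP.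
rewrite rootE hornerD hornerXn horner_poly; apply/eqP.
transitivity (l ^+ n * p.[x]); last by rewrite (rootP px0) mulr0.
rewrite (horner_coef_wide _ szp) [in RHS]big_ord_recr /= mulrDr addrC mulr_sumr.
congr (_ + _); last by rewrite exprMn exprSr !mulrA.
apply: eq_bigr => i _; have i_n : (i <= n)%N by rewrite -ltnS.
have -> : l ^+ n = l ^+ (n - i) * l ^+ i by rewrite -exprD subnK.
by rewrite exprMn [RHS]mulrCA -!mulrA.
Qed.

Lemma integral_drop_horner x p (k : nat) : p \is a polyOver (integral K) ->
  root p x -> (0 < k)%N -> (drop_poly k p).[x] \in integral K.
Proof.
move=> pO px0 k0; have [n] := ubnPleq (size p).
elim: n p pO px0 => [|[|n] IHn] p pO px0 szp.
- by rewrite drop_poly_eq0 ?horner0 ?rpred0 // (leq_trans szp).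
- by rewrite drop_poly_eq0 ?horner0 ?rpred0 // (leq_trans szp).
(* Writing the top term as [(l * x) * x^n] lowers the size bound; the coefficients stay integral and
   [x] stays a root. *)
set l := p`_n.+1; pose q := take_poly n.+1 p + (l * x)%:P * 'X^n.
have qO : q \is a polyOver (integral K).
  rewrite rpredD ?rpredM ?rpredX ?polyOverX ?polyOverC //.
    by apply/polyOver_poly => i _; apply/polyOverP.
  exact: integral_lead_mul.
have sq : (size q <= n.+1)%N.
  apply: leq_trans (size_polyD _ _) _; rewrite geq_max size_poly /=.
  by rewrite mul_polyC (leq_trans (size_scale_leq _ _)) ?size_polyXn.
have Ep : p = take_poly n.+1 p + l%:P * 'X^(n.+1).
  apply/polyP => i; rewrite coefD coef_take_poly coefCM coefXn.
  case: (ltngtP i n.+1) => [_|n_i|->]; rewrite ?mulr0 ?addr0 ?add0r ?mulr1 //.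
  by rewrite nth_default // (leq_trans szp).
have qx0 : root q x.
  move: px0; rewrite !rootE {1}Ep !hornerD !hornerCM !hornerXn.
  by rewrite exprS mulrA.
have [kn|kn|->] := ltngtP k n.+1; last first.
- suff -> : drop_poly n.+1 p = l%:P.
    by rewrite hornerC; apply/polyOverP.
  apply/polyP => i; rewrite coef_drop_poly coefC.
  by case: i => [|i]; rewrite ?add0n //= nth_default // (leq_trans szp) // addSn ltnS leq_addl.
- by rewrite drop_poly_eq0 ?horner0 ?rpred0 // (leq_trans szp).
suff -> : (drop_poly k p).[x] = (drop_poly k q).[x] by apply: IHn.
have dropC (c : K) (m : nat) : (k <= m)%N ->
    drop_poly k (c%:P * 'X^m) = c%:P * 'X^(m - k).
  move=> km; apply/polyP => i; rewrite coef_drop_poly !coefCM !coefXn.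
  by rewrite -[in LHS](subnK km) eqn_add2r.
rewrite {1}Ep /q !drop_polyD !dropC ?(ltnW kn) // !hornerD !hornerCM !hornerXn.
by rewrite subSn // exprS mulrA.
Qed.

(** Clear denominators in the minimal polynomial and take the primitive part. Contents carry the
    sign of the leading coefficient, so contents 1 also makes that coefficient positive. *)
Lemma primitive_int_root x : exists2 p : {poly int},
  zcontents p = 1 & root (map_poly intr p) x.
Proof.
have [q /polyOver1P [r Er] qx0] : exists2 q : {poly K}, q \is a polyOver 1%VS & (q != 0) && root q x.
  by exists (minPoly 1 x); rewrite ?minPolyOver // monic_neq0 ?monic_minPoly ?root_minPoly.
case/andP: qx0 => q0 qx0.
have [p [a a0 Ep]] := rat_poly_scale r.
have p0 : p != 0.
  by apply: contraNneq q0 => p0; rewrite Er Ep p0 map_poly0 scaler0 map_poly0.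
have pc0 : (zcontents p)%:~R != 0 :> rat by rewrite intr_eq0 zcontents_eq0.
exists (zprimitive p); first by rewrite zcontents_primitive p0.
have -> : map_poly intr (zprimitive p) =
    map_poly (in_alg K) (map_poly intr (zprimitive p)) :> {poly K}.
  by apply/polyP => i; rewrite !coef_map /= scaler_int.
move: qx0; rewrite Er Ep {1}[p]zpolyEprim.
rewrite !map_polyZ /= scalerA rootZ //.
by rewrite mulf_neq0 ?scaler_eq0 ?oner_eq0 ?orbF ?invr_eq0 ?intr_eq0 ?zcontents_eq0.
Qed.

(** The elements [p] and [q] lie in the inverse of the fractional ideal (1, x), and the last
    equation says that this ideal is invertible. *)
Lemma principal_localization x : exists p q : K,
  [/\ p \in integral K, p * x \in integral K, q \in integral K,
      q * x \in integral K & p + q * x = 1].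
Proof.
have [c c1 cx0] := primitive_int_root x.
have /= [u Eu] := bezout_big (fun i : 'I_(size c) => c`_i).
have {}Eu : \sum_(i < size c) u i * c`_i = 1.
  have lc0 : 0 < lead_coef c by rewrite -sgz_gt0 -sgz_contents c1.
  by rewrite Eu -[RHS]c1 /zcontents gtr0_sgz ?mul1r.
set P : {poly K} := map_poly intr c in cx0.
have PO : P \is a polyOver (integral K).
  by apply/polyOverP => i; rewrite coef_map rpred_int.
pose w k := (drop_poly k P).[x].
have w0 : w 0%N = 0 by rewrite /w drop_poly0l (rootP cx0).
have wO k : w k \in integral K.
  by case: k => [|k]; rewrite ?w0 ?rpred0 //; apply: integral_drop_horner.
have wE k : w k = x * w k.+1 + (c`_k)%:~R.
  have -> : w k = (drop_poly k.+1 P * 'X + (P`_k)%:P).[x].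
    congr _.[x]; apply/polyP => i.
    by rewrite coefD coefMX coefC !coef_drop_poly; case: i => [|i] /=;
      rewrite ?add0r ?addr0 // addSnnS.
  by rewrite hornerD hornerMX hornerC coef_map mulrC.
have xwO k : w k * x \in integral K.
  case: k => [|k]; first by rewrite w0 mul0r rpred0.
  have -> : w k.+1 * x = w k - (c`_k)%:~R by rewrite (wE k) addrK mulrC.
  by rewrite rpredB ?rpred_int ?wO.
(* As [w k - x * w k.+1] is the [k]-th coefficient of [c], the Bezout combination of these
   differences is 1. *)
exists (\sum_i (u i)%:~R * w i), (- \sum_i (u i)%:~R * w i.+1); split.
- by rewrite rpred_sum // => i _; rewrite rpredM ?rpred_int ?wO.
- by rewrite mulr_suml rpred_sum // => i _; rewrite -mulrA rpredM ?rpred_int ?xwO.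
- by rewrite rpredN rpred_sum // => i _; rewrite rpredM ?rpred_int ?wO.
- by rewrite mulNr rpredN mulr_suml rpred_sum // => i _; rewrite -mulrA rpredM ?rpred_int ?xwO.
rewrite mulNr mulr_suml -sumrB.
transitivity ((\sum_(i < size c) u i * c`_i)%:~R : K); last by rewrite Eu.
rewrite rmorph_sum; apply: eq_bigr => i _.
by rewrite -mulrA -mulrBr (wE i) [x * _]mulrC addrAC subrr add0r rmorphM.
Qed.
End Integrality.

(** * Projectivity of torsion-free modules *)

Section Projectivity.
Variable K : fieldExtType rat.
Local Notation O := (ringOfIntegers K).
Implicit Types a b : O.

(** A partition of unity: [a] divides [b] once [s] is inverted, and [b] divides [a] once [t] is. It
    comes from the ideal (1, b/a), with [t = q * (b/a)]. *)
Lemma pair_localization a b : exists s t c d : O,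
  [/\ s + t = 1, s * b = a * c & t * a = b * d].
Proof.
have [->|a0] := eqVneq a 0.
  by exists 0, 1, 0, 0; rewrite add0r !mul0r !mulr0.
have va0 : integer_val a != 0 by rewrite -(inj_eq val_inj) in a0.
have [p [q [pO pxO qO qxO pqx]]] :=
  principal_localization (integer_val b / integer_val a).
exists (RingOfIntegers pO), (RingOfIntegers qxO).
exists (RingOfIntegers pxO), (RingOfIntegers qO).
split; apply: val_inj; rewrite /= -?pqx //=.
- by rewrite mulrCA (mulrC (integer_val a)) divfK.
- by rewrite -mulrA divfK // mulrC.
Qed.

(** Where [s i] is inverted, [a i] divides the whole family. By induction, each piece for the first
    entries is split by comparing its divisor with the last entry; the parts where the last entry
    wins are added up. *)
Lemma family_localization (n : nat) (a : 'I_n.+1 -> O) : exists s : 'I_n.+1 -> O,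
  \sum_i s i = 1 /\ forall i j, exists c, s i * a j = a i * c.
Proof.
elim: n a => [|n IHn] a.
  exists (fun=> 1); split; first by rewrite big_ord1.
  by move=> i j; exists 1; rewrite mul1r mulr1 !ord1.
have [s [s1 sa]] := IHn (fun i => a (lift ord_max i)).
pose am := a ord_max.
have /choice [P HP] (i : 'I_n.+1) : exists pq : O * O, pq.1 + pq.2 = 1 /\
    exists c d, pq.1 * am = a (lift ord_max i) * c /\
                pq.2 * a (lift ord_max i) = am * d.
  have [p [q [c [d [pq Ec Ed]]]]] := pair_localization (a (lift ord_max i)) am.
  by exists (p, q); split=> //; exists c, d.
pose s' i := if unlift ord_max i is Some j then s j * (P j).1
             else \sum_j s j * (P j).2.
have s'l j : s' (lift ord_max j) = s j * (P j).1 by rewrite /s' liftK.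
have s'm : s' ord_max = \sum_j s j * (P j).2 by rewrite /s' unlift_none.
exists s'; split.
  rewrite (bigD1_ord ord_max) //= s'm (eq_bigr _ (fun j _ => s'l j)) -big_split /= -s1.
  by apply: eq_bigr => j _; rewrite -mulrDr addrC (HP j).1 mulr1.
move=> i j; case: (unliftP ord_max i) => [i'|] ->.
  have [_ [c [d [Ec Ed]]]] := HP i'.
  rewrite s'l; case: (unliftP ord_max j) => [j'|] ->.
    by have [b Eb] := sa i' j'; exists ((P i').1 * b); rewrite mulrAC Eb -mulrA (mulrC b).
  by exists (s i' * c); rewrite -mulrA Ec mulrCA.
rewrite s'm mulr_suml.
suff /choice [e Ee] (k : 'I_n.+1) : exists e, s k * (P k).2 * a j = am * e.
  by exists (\sum_k e k); rewrite mulr_sumr; apply: eq_bigr => k _; rewrite Ee.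
(* On this piece the last entry divides the [k]-th one, which divides all the earlier ones. *)
have [_ [c [d [Ec Ed]]]] := HP k.
case: (unliftP ord_max j) => [j'|] ->; last first.
  by exists (s k * (P k).2); rewrite mulrC.
have [b Eb] := sa k j'; exists (d * b).
by rewrite mulrAC Eb [LHS]mulrC [LHS]mulrA Ed -mulrA.
Qed.

Variable M : lmodType O.
Implicit Types (u v : M).

Definition spans (n : nat) (g : 'I_n -> M) v := exists c : 'I_n -> O, v = \sum_i c i *: g i.

Lemma spansP (n : nat) (g : 'I_n -> M) a u v :
  spans g u -> spans g v -> spans g (a *: u + v).
Proof.
move=> [c ->] [d ->]; exists (fun i => a * c i + d i).
rewrite scaler_sumr -big_split; apply: eq_bigr => i _.
by rewrite scalerDl scalerA.
Qed.

(* Multiplication by [s] on the span of [g] factors through a free module of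
   finite rank; the functionals need to be linear only on that span. *)
Definition factors_free (n : nat) (g : 'I_n -> M) (s : O) :=
  exists (m : nat) (f : 'I_m -> M -> O) (x : 'I_m -> M),
  (forall k a u v, spans g u -> spans g v ->
     f k (a *: u + v) = a * f k u + f k v) /\
  (forall v, spans g v -> s *: v = \sum_k f k v *: x k).

Lemma factors_free0 (n : nat) (g : 'I_n -> M) : factors_free g 0.
Proof.
exists 0%N, (fun _ _ => 0), (fun=> 0); split=> [[]//|v _].
by rewrite big_ord0 scale0r.
Qed.

(** Concatenating factorizations adds the multipliers; a partition of unity thus glues local
    factorizations into one for 1. *)
Lemma factors_freeD (n : nat) (g : 'I_n -> M) s t :
  factors_free g s -> factors_free g t -> factors_free g (s + t).
Proof.
move=> [m [f [x [fL fE]]]] [m' [f' [x' [fL' fE']]]].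
exists (m + m')%N, (fun i v => match split i with inl j => f j v | inr j => f' j v end),
  (fun i => match split i with inl j => x j | inr j => x' j end); split.
  by move=> k a u v gu gv; case: split => j; [apply: fL | apply: fL'].
move=> v gv; rewrite big_split_ord scalerDl fE // fE' //.
congr (_ + _); apply: eq_bigr => i _.
  by rewrite (unsplitK (inl i : 'I_m + 'I_m')).
by rewrite (unsplitK (inr i : 'I_m + 'I_m')).
Qed.

Lemma factors_free_sum (n k : nat) (g : 'I_n -> M) (s : 'I_k -> O) :
  (forall i, factors_free g (s i)) -> factors_free g (\sum_i s i).
Proof.
move=> gs; apply: (big_ind (factors_free g)) => //.
  exact: factors_free0.
exact: factors_freeD.
Qed.

Lemma factors_free_span (n m : nat) (g : 'I_n -> M) (g' : 'I_m -> M) s :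
  (forall v, spans g v -> spans g' (s *: v)) ->
  factors_free g' 1 -> factors_free g s.
Proof.
move=> gg' [k [f [x [fL fE]]]]; exists k, (fun i v => f i (s *: v)), x; split.
  move=> i a u v gu gv; rewrite scalerDr scalerA mulrC -scalerA.
  by rewrite fL //; apply: gg'.
by move=> v gv; rewrite -fE ?scale1r //; apply: gg'.
Qed.

Lemma factors_free_independent (n : nat) (g : 'I_n -> M) :
  (forall a : 'I_n -> O, \sum_i a i *: g i = 0 -> forall i, a i = 0) ->
  factors_free g 1.
Proof.
(* Vectors outside the span receive arbitrary coordinates. *)
move=> gfree; have /choice [f fE] v : exists c : 'I_n -> O,
    spans g v -> v = \sum_i c i *: g i.
  have [[c Ec]|nv] := pselect (spans g v); first by exists c.
  by exists (fun=> 0).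
exists n, (fun i v => f v i), g; split; last by move=> v /fE; rewrite scale1r.
move=> i a u v gu gv; apply/eqP; rewrite -subr_eq0; apply/eqP.
apply: (gfree (fun i => f (a *: u + v) i - (a * f u i + f v i))).
under eq_bigr do rewrite scalerBl scalerDl -scalerA.
rewrite sumrB big_split /= -scaler_sumr -fE; last exact: spansP.
by rewrite -!fE // subrr.
Qed.

(* The relation [a] localizes to one in which a generator has coefficient
   [s i]; then [s i] multiplies the whole span into that of the others. *)
Lemma torsion_free_factors_free (n : nat) (g : 'I_n -> M) :
  torsion_free M -> factors_free g 1.
Proof.
move=> Mtf; elim: n g => [|n IHn] g.
  by apply: factors_free_independent => a _ [].
have [gfree|] := pselect (forall a : 'I_n.+1 -> O,
  \sum_i a i *: g i = 0 -> forall i, a i = 0).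
  exact: factors_free_independent.
move=> /existsNP [a /not_implyP [a_rel /existsNP [j /eqP aj0]]].
have [s [s1 sa]] := family_localization a.
rewrite -s1; apply: factors_free_sum => i.
(* If [a i = 0], then [s i * a j = 0] with [a j] nonzero, so [s i = 0]. *)
have [ai0|ai0] := eqVneq (a i) 0.
  have [c] := sa i j; rewrite ai0 mul0r => /eqP.
  rewrite mulf_eq0 (negbTE aj0) orbF => /eqP ->; exact: factors_free0.
apply: (@factors_free_span _ _ _ (fun k => g (lift i k))) => // v [c ->].
have /choice [b Eb] := sa i.
have bii : b i = s i by apply: (mulfI ai0); rewrite -Eb mulrC.
have sgi : s i *: g i = - \sum_k b (lift i k) *: g (lift i k).
  apply/eqP; rewrite -addr_eq0 -bii.
  have <- : \sum_k b k *: g k = b i *: g i + \sum_k b (lift i k) *: g (lift i k).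
    by rewrite (bigD1_ord i).
  (* The relation [b] times [a i] is the relation [a] times [s i]; torsion-freeness cancels
     [a i]. *)
  have : a i *: \sum_k b k *: g k = 0.
    transitivity (s i *: \sum_k a k *: g k); last by rewrite a_rel scaler0.
    by rewrite !scaler_sumr; apply: eq_bigr => k _; rewrite !scalerA Eb.
  by move=> /Mtf [/eqP|/eqP //]; rewrite (negbTE ai0).
exists (fun k => s i * c (lift i k) - c i * b (lift i k)).
rewrite (bigD1_ord i) //= scalerDr scalerA mulrC -scalerA sgi.
rewrite scalerN !scaler_sumr addrC -sumrB; apply: eq_bigr => k _.
by rewrite scalerBl !scalerA.
Qed.

(** Projectivity in the form of a dual basis. The span of a generating family is all of [M], so the
    functionals are now linear everywhere. *)
Lemma fg_torsion_free_projective : finitely_generated M -> torsion_free M ->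
  exists (m : nat) (f : 'I_m -> M -> O) (x : 'I_m -> M),
  (forall k a u v, f k (a *: u + v) = a * f k u + f k v) /\
  (forall v, v = \sum_k f k v *: x k).
Proof.
move=> [n [g gE]] /(torsion_free_factors_free g) [m [f [x [fL fE]]]].
have gs v : spans g v by have [c ->] := gE v; exists c.
exists m, f, x; split=> [k a u v|v]; first exact: fL.
by rewrite -fE // scale1r.
Qed.
End Projectivity.

(** * Embeddings of a number field *)

(** Send [q(x)] to [q(y)]: every element of [E] has this form, and the second hypothesis makes the
    value independent of [q]. *)
Lemma lift_embedding (F : fieldType) (E L : comNzRingType) (i : {rmorphism F -> E})
    (e : {rmorphism F -> L}) (x : E) (y : L) :
  (forall u : E, exists q : {poly F}, u = (map_poly i q).[x]) ->
  (forall q : {poly F}, (map_poly i q).[x] = 0 -> (map_poly e q).[y] = 0) ->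
  exists s : {rmorphism E -> L}, (forall a, s (i a) = e a) /\ s x = y.
Proof.
move=> /choice [q qE] xy; pose s u := (map_poly e (q u)).[y].
have sE p : s (map_poly i p).[x] = (map_poly e p).[y].
  apply/eqP; rewrite -subr_eq0 -hornerN -hornerD -rmorphB; apply/eqP/xy.
  by rewrite rmorphB hornerD hornerN -qE subrr.
have s_zmod : zmod_morphism s.
  move=> u v; rewrite {1}(qE u) {1}(qE v) -hornerN -hornerD -rmorphB sE.
  by rewrite rmorphB hornerD hornerN.
have s_monoid : monoid_morphism s.
  split=> [|u v]; first by have := sE 1; rewrite !rmorph1 !hornerC.
  by rewrite {1}(qE u) {1}(qE v) -hornerM -rmorphM sE rmorphM hornerM.
pose sA := GRing.isZmodMorphism.Build _ _ s s_zmod.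
pose sM := GRing.isMonoidMorphism.Build _ _ s s_monoid.
exists (HB.pack s sA sM : {rmorphism E -> L}) => /=; split=> [a|].
  by have := sE a%:P; rewrite !map_polyC !hornerC.
by have := sE 'X; rewrite !map_polyX !hornerX.
Qed.

Section Embeddings.
Variable K : fieldExtType rat.

(** First embed the subfield generated by [b] by sending [b] to [z], then extend to [K] through a
    primitive element. *)
Lemma embedding_of_root (b : K) (z : algC) :
  (forall q : {poly rat}, root (map_poly (in_alg K) q) b -> root (map_poly ratr q) z) ->
  exists s : {rmorphism K -> algC}, s b = z.
Proof.
move=> bz; pose E : {subfield K} := <<1; b>>%AS.
pose b' : subvs_of E := Subvs (memv_adjoin 1 b).
have valE q : vsval (map_poly (in_alg (subvs_of E)) q).[b'] =
    (map_poly (in_alg K) q).[b].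
  rewrite -horner_map /= -map_poly_comp; congr _.[_].
  apply/polyP => i; rewrite !coef_map /=.
  by rewrite algid1.
have [||e [_ eb]] := @lift_embedding _ (subvs_of E) _ (in_alg (subvs_of E)) ratr b' z.
- move=> u; have /Fadjoin1_polyP [q Eq] := valP u.
  by exists q; apply: val_inj; rewrite /= valE.
- by move=> q qb; apply/rootP/bz/rootP; rewrite -valE qb linear0.
pose g := separable_generator E fullv.
have Eg : <<E; g>>%VS = fullv.
  rewrite -eq_adjoin_separable_generator ?subvf //.
  apply/separableP => u _; apply: pcharf0_separable => p.
  by rewrite pchar_lalg; apply: pchar_num.
have /polyOver_subvs [m Em] := minPolyOver E g.
(* The primitive element [g] goes to a root of its minimal polynomial transported along [e]. *)
have [r mr] : exists r : algC, root (map_poly e m) r.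
  apply/closed_rootP; rewrite size_map_poly.
  by rewrite -(size_map_poly vsval) -Em size_minPoly.
have [||s [se _]] := @lift_embedding (subvs_of E) K algC vsval e g r.
- move=> u; have /Fadjoin_polyP [p /polyOver_subvs [q ->] ->] : u \in <<E; g>>%VS.
    by rewrite Eg memvf.
  by exists q.
- move=> q /rootP qg; apply/rootP.
  have /dvdpP [d ->] : m %| q.
    by rewrite -(dvdp_map vsval) -Em minPoly_dvdp //; apply/polyOver_subvs; exists q.
  by rewrite rmorphM rootM mr orbT.
by exists s; rewrite -eb -se.
Qed.
End Embeddings.

(** * Integers with small conjugates *)

Section SmallConjugates.
Variable K : fieldExtType rat.
Local Notation O := (ringOfIntegers K).

(** The constant coefficient of the minimal polynomial serves as the norm: it is a rational integer,
    nonzero if [b] is, and up to sign a product of conjugates. *)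
Lemma small_conjugates_eq0 (b : O) :
  (forall s : {rmorphism K -> algC}, 0 <= s (integer_val b) /\ s (integer_val b) * 2 <= 1) ->
  b = 0.
Proof.
move=> b_small; apply/eqP/negPn/negP => b0.
have vb0 : integer_val b != 0 by rewrite -(inj_eq val_inj) in b0.
have /polyOver1P [m Em] := minPolyOver 1 (integer_val b).
have m_dvd (q : {poly rat}) : root (map_poly (in_alg K) q) (integer_val b) -> m %| q.
  move=> qb; rewrite -(dvdp_map (in_alg K)) -Em minPoly_dvdp //.
  by apply/polyOver1P; exists q.
have [z mz] : exists z : algC, root (map_poly ratr m) z.
  apply/closed_rootP; rewrite size_map_poly.
  by rewrite -(size_map_poly (in_alg K)) -Em size_minPoly.
have [p [Ep p_mon] p_dvd] := minCpolyP z.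
(* Any rational polynomial vanishing at [b] is a multiple of [m], hence of the minimal polynomial of
   [z], and so vanishes at [y]. *)
have conj y : root (minCpoly z) y -> exists s : {rmorphism K -> algC}, s (integer_val b) = y.
  rewrite Ep => py; apply: embedding_of_root => q /m_dvd /dvdpP [d ->].
  move: mz; rewrite p_dvd => /dvdpP [d' ->].
  by rewrite !rmorphM !rootM py !orbT.
have z_int : z \in Aint.
  have [s <-] := conj z (root_minCpoly z).
  have /integralP [P P_mon Pb] := integer_valP b.
  apply: (@root_monic_Aint (map_poly intr P)).
  - have -> : map_poly intr P = map_poly s (map_poly intr P) :> {poly algC}.
      by apply/polyP => i; rewrite !coef_map /= rmorph_int.
    by rewrite fmorph_root.
  - exact: monic_map.
  - by apply/polyOverP => i; rewrite coef_map /= intr_int.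
have [r Er] := closed_field_poly_normal (minCpoly z).
rewrite (monicP (minCpoly_monic z)) scale1r in Er.
have r_small y : y \in r -> 0 < `|y| /\ `|y| * 2 <= 1.
  rewrite -root_prod_XsubC -Er => /conj [s <-].
  have [s0 s1] := b_small s; rewrite ger0_norm //; split=> //.
  by rewrite lt_def s0 fmorph_eq0 vb0.
have : (minCpoly z)`_0 \in Num.int by apply/polyOverP.
rewrite -horner_coef0 Er horner_prod => /norm_intr_ge1 ge1.
have : 1 <= `|\prod_(y <- r) ('X - y%:P).[0]|.
  apply: ge1; rewrite prodf_seq_neq0; apply/allP => y /r_small [y0 _].
  by rewrite hornerXsubC sub0r oppr_eq0 -normr_gt0.
(* An empty product would be 1 and give no contradiction. *)
have : (0 < size r)%N.
  by have := size_minCpoly z; rewrite Er size_prod_XsubC ltnS.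
rewrite normr_prod; under eq_bigr do rewrite hornerXsubC sub0r normrN.
case: r r_small {Er ge1} => [//|y r] r_small _.
have [y0 y1] := r_small y (mem_head _ _).
rewrite big_cons => /le_gtF/negP; apply.
apply: (@le_lt_trans _ _ (`|y| * 1)).
  apply: ler_wpM2l => [|{y0 y1}]; first exact: ltW.
  rewrite big_seq; apply: prodr_ile1 => w wr; rewrite normr_ge0 /=.
  have [w0 w1] : 0 < `|w| /\ `|w| * 2 <= 1 by apply: r_small; rewrite inE wr orbT.
  by apply: le_trans w1; rewrite ler_peMr ?ler1n // ltW.
by rewrite mulr1; apply: lt_le_trans y1; rewrite ltr_pMr // ltr1n.
Qed.
End SmallConjugates.

(** * The free cover of a lattice *)

Lemma two_neq0 (K : fieldExtType rat) : 2 != 0 :> K.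
Proof. by rewrite -(rmorph_nat (in_alg K)) fmorph_eq0. Qed.

Section FreeCover.
Variables (K : fieldExtType rat) (K_real : totally_real K) (L : lattice K).
Local Notation O := (ringOfIntegers K).
Local Notation B := (polar_form (@lattice_form K L)).
Variables (m : nat) (f : 'I_m -> L -> O) (x : 'I_m -> L).
Hypothesis f_linear : forall k a u v, f k (a *: u + v) = a * f k u + f k v.
Hypothesis fK : forall v, v = \sum_k f k v *: x k.
Variables (c : O) (c_pos : totally_positive c).
Implicit Types (y u v : 'rV[O]_m).

Definition cover_map y : L := \sum_k y 0 k *: x k.
(** Coordinates of the projection onto the kernel of [cover_map], along the image of the section
    [w |-> (f k w)_k]. *)
Definition cover_err (k : 'I_m) y : O := y 0 k - f k (cover_map y).
Definition err_norm y : O := \sum_k cover_err k y ^+ 2.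
(* On [O^m = L (+) ker cover_map], the form of [L] plus [c] times the standard
   form of the second component. *)
Definition cover_form y : O := lattice_form (cover_map y) + c * err_norm y.


Lemma cover_map_linear a u v : cover_map (a *: u + v) = a *: cover_map u + cover_map v.
Proof.
rewrite /cover_map scaler_sumr -big_split; apply: eq_bigr => k _.
by rewrite !mxE scalerDl scalerA.
Qed.

Lemma cover_err_linear k a u v :
  cover_err k (a *: u + v) = a * cover_err k u + cover_err k v.
Proof.
by rewrite /cover_err cover_map_linear f_linear !mxE mulrBr opprD addrACA.
Qed.

Lemma cover_mapZ a v : cover_map (a *: v) = a *: cover_map v.
Proof.
rewrite /cover_map scaler_sumr; apply: eq_bigr => k _.
by rewrite !mxE scalerA.
Qed.

Lemma cover_errZ k a v : cover_err k (a *: v) = a * cover_err k v.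
Proof.
have c0 : cover_map 0 = 0.
  by rewrite /cover_map big1 // => i _; rewrite mxE scale0r.
have f0 : f k 0 = 0.
  by have := f_linear k (-1) 0 0; rewrite scaler0 addr0 mulN1r addNr.
have e0 : cover_err k 0 = 0 by rewrite /cover_err mxE c0 f0 subrr.
by rewrite -[a *: v]addr0 cover_err_linear e0 addr0.
Qed.

(** The cross terms of the squares carry a factor 2 that cancels the 1/2. The added part is
    therefore integral, which keeps classical lattices classical. *)
Lemma cover_polarE u v : polar_form cover_form u v =
  B (cover_map u) (cover_map v) +
  integer_val c * \sum_k integer_val (cover_err k u) * integer_val (cover_err k v).
Proof.
have two0 := two_neq0 K.
have cD : cover_map (u + v) = cover_map u + cover_map v.
  by rewrite -[u in LHS]scale1r cover_map_linear scale1r.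
have eD k : cover_err k (u + v) = cover_err k u + cover_err k v.
  by rewrite -[u in LHS]scale1r cover_err_linear mul1r.
have eN : err_norm (u + v) = err_norm u + err_norm v +
    2 * \sum_k cover_err k u * cover_err k v.
  rewrite /err_norm mulr_sumr -!big_split; apply: eq_bigr => k _.
  by rewrite /= eD sqrrD addrAC mulr_natl.
apply: (mulfI two0); rewrite {1}/polar_form mulrCA divff // mulr1.
rewrite mulrDr /polar_form [2 * (_ / 2)]mulrCA divff // mulr1.
rewrite /cover_form eN cD.
have -> : \sum_k integer_val (cover_err k u) * integer_val (cover_err k v) =
    integer_val (\sum_k cover_err k u * cover_err k v).
  by rewrite rmorph_sum; apply: eq_bigr => k _; rewrite rmorphM.
by rewrite !(rmorphB, rmorphD, rmorphM) /=; ring.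
Qed.

Lemma cover_formZ a v : cover_form (a *: v) = a ^+ 2 * cover_form v.
Proof.
rewrite /cover_form cover_mapZ lattice_formZ mulrDr; congr (_ + _).
rewrite mulrCA; congr (_ * _); rewrite /err_norm mulr_sumr.
by apply: eq_bigr => k _; rewrite cover_errZ exprMn.
Qed.

Lemma cover_bilinear : bilinear_form (polar_form cover_form).
Proof.
have [Bl Br] := lattice_bilinear L.
have eL k a u v : integer_val (cover_err k (a *: u + v)) =
    integer_val a * integer_val (cover_err k u) + integer_val (cover_err k v).
  by rewrite cover_err_linear [LHS](rmorphD (@integer_val K)) [X in X + _]rmorphM.
split=> a u v w; rewrite !cover_polarE cover_map_linear ?Bl ?Br.
  rewrite mulrDr addrACA; congr (_ + _); rewrite mulrCA -mulrDr.
  congr (_ * _); rewrite mulr_sumr -big_split; apply: eq_bigr => k _.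
  by rewrite eL mulrDl mulrA.
rewrite mulrDr addrACA; congr (_ + _); rewrite mulrCA -mulrDr.
congr (_ * _); rewrite mulr_sumr -big_split; apply: eq_bigr => k _.
by rewrite eL mulrDr mulrCA.
Qed.

(** As [K] is totally real, a conjugate of a square is the square of a real number. *)
Lemma embedding_sqr_ge0 (s : {rmorphism K -> algC}) (a : O) : 0 <= s (integer_val (a ^+ 2)).
Proof. by rewrite !rmorphXn /= real_exprn_even_ge0. Qed.

Lemma err_norm_ge0 (s : {rmorphism K -> algC}) v : 0 <= s (integer_val (err_norm v)).
Proof.
rewrite /err_norm !rmorph_sum; apply: sumr_ge0 => k _.
exact: embedding_sqr_ge0.
Qed.

Lemma lattice_form_ge0 (s : {rmorphism K -> algC}) (w : L) :
  0 <= s (integer_val (lattice_form w)).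
Proof.
have [->|w0] := eqVneq w 0; last exact/ltW/lattice_positive.
by rewrite -(scale0r (0 : L)) lattice_formZ expr0n mul0r !rmorph0.
Qed.

Lemma cover_positive v : v != 0 -> totally_positive (cover_form v).
Proof.
move=> v0 s; rewrite /cover_form !rmorphD !rmorphM /=.
have sc : 0 < s (integer_val c) := c_pos s.
have [w0|w0] := eqVneq (cover_map v) 0; last first.
  apply: ltr_wpDr; last exact: lattice_positive.
  by apply: mulr_ge0; [exact: ltW | exact: err_norm_ge0].
apply: ltr_wpDl; first exact: lattice_form_ge0.
apply: mulr_gt0 => //.
have /rV0Pn [k vk] := v0.
(* A vector in the kernel of [cover_map] is its own error, so a nonzero coordinate contributes a
   positive square. *)
have ek : cover_err k v = v 0 k.
  rewrite /cover_err w0; have := f_linear k (-1) 0 0.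
  by rewrite scaler0 addr0 mulN1r addNr => ->; rewrite subr0.
have sk : 0 < s (integer_val (cover_err k v ^+ 2)).
  rewrite lt_def embedding_sqr_ge0 fmorph_eq0 andbT ek.
  by rewrite (inj_eq val_inj _ 0) expf_neq0.
rewrite /err_norm (bigD1 k) // !rmorphD; apply: ltr_wpDr => //.
by rewrite !rmorph_sum; apply: sumr_ge0 => i _; apply: embedding_sqr_ge0.
Qed.

Lemma row_fg : finitely_generated 'rV[O]_m.
Proof.
exists m, (fun k => delta_mx 0 k) => v; exists [ffun k => v 0 k].
by rewrite {1}(row_sum_delta v); apply: eq_bigr => k _; rewrite ffunE.
Qed.

Lemma row_torsion_free : torsion_free 'rV[O]_m.
Proof. by move=> a v /eqP; rewrite scalemx_eq0 => /orP [] /eqP; [left|right]. Qed.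

Lemma row_free_module : free_module 'rV[O]_m.
Proof.
exists m, (fun k => delta_mx 0 k) => v; exists [ffun k => v 0 k]; split.
  by rewrite {1}(row_sum_delta v); apply: eq_bigr => k _; rewrite ffunE.
move=> d ->; apply/ffunP => k; rewrite ffunE summxE (bigD1 k) //= big1.
  by rewrite !mxE !eqxx mulr1 addr0.
by move=> i ik; rewrite !mxE eqxx (eq_sym k) (negbTE ik) mulr0.
Qed.

Definition free_cover : lattice K :=
  Lattice row_fg row_torsion_free cover_formZ cover_bilinear cover_positive.

Lemma free_cover_of_kind (X : lattice_kind) : of_kind X L -> of_kind X free_cover.
Proof.
case: X => //= Lcl u v; rewrite cover_polarE rpredD ?Lcl //.
rewrite rpredM ?integer_valP // rpred_sum // => k _.
by rewrite rpredM ?integer_valP.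
Qed.

Lemma free_cover_represents a : represents L a -> represents free_cover a.
Proof.
(* The image of [w] under the section has no component in the kernel. *)
move=> [w <-]; exists (\row_k f k w) => /=.
have Ew : cover_map (\row_k f k w) = w.
  by rewrite /cover_map [RHS]fK; apply: eq_bigr => k _; rewrite mxE.
rewrite /cover_form /err_norm big1 ?mulr0 ?addr0 ?Ew // => k _.
by rewrite /cover_err Ew mxE subrr expr0n.
Qed.

(* If [a = Q w + 2 a b] then every conjugate of the integer [b] is at most 1/2. *)
Lemma represents_of_free_cover a :
  totally_positive a -> c = 2 * a -> represents free_cover a -> represents L a.
Proof.
move=> a_pos Ec [v Ev]; exists (cover_map v).
suff E0 : err_norm v = 0 by rewrite -[RHS]Ev /= /cover_form E0 mulr0 addr0.
apply: small_conjugates_eq0 => s; split; first exact: err_norm_ge0.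
have sa : 0 < s (integer_val a) := a_pos s.
have := lattice_form_ge0 s (cover_map v).
have -> : lattice_form (cover_map v) = a * (1 - err_norm v * 2).
  by rewrite mulrBr mulr1 -{1}Ev /= /cover_form Ec; ring.
rewrite !rmorphM pmulr_rge0 // !rmorphB !rmorphM !rmorph1 !rmorph_nat subr_ge0.
exact.
Qed.
End FreeCover.

Theorem theorem5p1 (K : fieldExtType rat) (K_real : totally_real K)
    (S C : set (set (ringOfIntegers K)))
    (S_classes : S `<=` positive_classes K) (CS : C `<=` S)
    (X : lattice_kind) :
  criterion_set S X C <->
  (forall L : lattice K, of_kind X L -> free_lattice L ->
     (universal S L <-> universal C L)).
Proof.
split=> [[_ crit] L LX _|free_crit]; first exact: crit.
split=> // L LX; split=> [LS a a_pos /CS|LC a a_pos Sa]; first exact: LS.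
have [m [f [x [f_lin fK]]]] :=
  fg_torsion_free_projective (lattice_fg L) (@lattice_torsion_free K L).
(* The scale depends on [a], so each [a] gets its own free cover. *)
have c_pos : totally_positive (2 * a).
  move=> s; rewrite !rmorphM !rmorph_nat; apply: mulr_gt0; first exact: ltr0n.
  exact: a_pos.
apply: (represents_of_free_cover (c_pos := c_pos) (f_linear := f_lin) (x := x) (K_real := K_real)) => //.
(* The cover represents all that [L] does, so it is [C]-universal; being free, it is then
   [S]-universal and represents [a]. *)
apply: (free_crit _ _ _).2 => //.
- exact: free_cover_of_kind.
- exact: row_free_module.
by move=> b b_pos Cb; apply: free_cover_represents => //; apply: LC.
Qed.
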